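(* Let $\langle\mathbf{A}_{\mathrm d},\mathbf{A},\iota\rangle$ be a (generalized) additive quantale with multiplication. Then an $\mathbf{A}$-module $\mathbf{P}$ is projective if and only if for every $\mathbf{A}$-module $\mathbf{Q}$, every pair of structural nuclei $\gamma$ on $\mathbf{P}$ and $\delta$ on $\mathbf{Q}$, and every embedding (injective homomorphism) of modules $f\colon\mathbf{P}_\gamma\hookrightarrow\mathbf{Q}_\delta$, there is a homomorphism of modules $\tau\colon\mathbf{P}\to\mathbf{Q}$ with $f\circ\gamma=\delta\circ\tau$.
   Context: Fix one of two parallel settings: plain (''joins'' = joins of arbitrary families) or generalized (''joins'' = joins of non-empty families). A (generalized) quantale is $\langle Q,\bigvee,+,\mathsf{0}\rangle$ with $Q$ a poset having all such joins, $\langle Q,+,\mathsf{0}\rangle$ a monoid with $+$ order-preserving and distributing over such joins on both sides. A (generalized) additive quantale with multiplication is a triple $\langle\mathbf{A}_{\mathrm d},\mathbf{A},\iota\rangle$: $\mathbf{A}_{\mathrm d}$ a monoid, $\mathbf{A}$ a (generalized) quantale with an additional monoid structure $\langle A,\cdot,\mathsf 1\rangle$, $\iota$ a monoid homomorphism, such that $(\bigvee_i a_i)\cdot b=\bigvee_i(a_i\cdot b)$, $(a+b)\cdot c=a\cdot c+b\cdot c$, $\mathsf0\cdot a=\mathsf0$, and for $d\in\mathbf{A}_{\mathrm d}$ left multiplication by $\iota(d)$ preserves joins, $+$, $\mathsf0$. An $\mathbf{A}$-module is a (generalized) quantale $\mathbf{Q}$ with $\ast\colon A\times Q\to Q$,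 order-preserving in both coordinates, with $(a\cdot b)\ast x=a\ast(b\ast x)$, $\mathsf1\ast x=x$, $(a+b)\ast x=a\ast x+b\ast x$, $\mathsf0\ast x=\mathsf0$, $(\bigvee_i a_i)\ast x=\bigvee_i(a_i\ast x)$, and $x\mapsto\iota(d)\ast x$ preserving $+$, $\mathsf0$, joins for $d\in\mathbf{A}_{\mathrm d}$; module homomorphisms are quantale homomorphisms $f$ with $f(a\ast x)=a\ast f(x)$. $\mathbf{P}$ is projective if for every surjective module homomorphism $g\colon\mathbf{R}\to\mathbf{S}$ and every module homomorphism $h\colon\mathbf{P}\to\mathbf{S}$ there is a module homomorphism $h'\colon\mathbf{P}\to\mathbf{R}$ with $g\circ h'=h$. A structural nucleus on a module $\mathbf{Q}$ is an order-preserving, expansive ($x\le\gamma(x)$), idempotent map $\gamma$ with $\gamma(x)+\gamma(y)\le\gamma(x+y)$ and $a\ast\gamma(x)\le\gamma(a\ast x)$ for all $a\in A$; $\mathbf{Q}_\gamma$ is the module on $\gamma[Q]$ with $\bigvee_\gamma X=\gamma(\bigvee X)$, $x+_\gamma y=\gamma(x+y)$, $\mathsf0_\gamma=\gamma(\mathsf0)$, $a\ast_\gamma x=\gamma(a\ast x)$, and $\gamma$ is regarded as a surjective module homomorphism $\mathbf{Q}\to\mathbf{Q}_\gamma$. *)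

(* Defs.v *)
From HB Require Import structures.
From mathcomp Require Import all_boot all_order.
From mathcomp Require Import boolp classical_sets.

Set Implicit Arguments.
Unset Strict Implicit.
Unset Printing Implicit Defensive.

Import Order.POrderTheory.
Local Open Scope classical_set_scope.
Local Open Scope order_scope.

(* The two parallel settings: joins of arbitrary sets in [Plain], joins of    *)
(* nonempty sets only in [Generalized].                                       *)
Variant setting := Plain | Generalized.

Definition joinable (s : setting) (T : Type) (X : set T) : Prop :=
  match s with Plain => True | Generalized => X !=set0 end.

(* [baseAddUMagmaType] is the bare signature (+, 0): addition in a quantale   *)
(* need not be commutative, so [nmodType] would be too strong. Every axiom    *)
(* and every notion below only constrains [qjoin] on joinable sets.           *)
HB.mixin Record isQuantale (s : setting) (d : Order.disp_t) Q
    of Order.POrder d Q & Algebra.BaseAddUMagma Q := {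
  qjoin : set Q -> Q;
  qjoinP : forall X : set Q, joinable s X -> supremums X (qjoin X);
  qaddA : associative (@Algebra.add Q);
  qadd0x : left_id (0%R : Q) (@Algebra.add Q);
  qaddx0 : right_id (0%R : Q) (@Algebra.add Q);
  qadd_le : forall x x' y y' : Q,
    x <= x' -> y <= y' -> (x + y)%R <= (x' + y')%R;
  qadd_joinl : forall (X : set Q) (y : Q), joinable s X ->
    (qjoin X + y)%R = qjoin [set (x + y)%R | x in X];
  qadd_joinr : forall (y : Q) (X : set Q), joinable s X ->
    (y + qjoin X)%R = qjoin [set (y + x)%R | x in X]
}.

#[short(type="quantaleType")]
HB.structure Definition Quantale (s : setting) (d : Order.disp_t) :=
  {Q of Order.POrder d Q & Algebra.BaseAddUMagma Q & isQuantale s d Q}.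

Definition quantale_morphism (s : setting) (d d' : Order.disp_t)
    (Q : quantaleType s d) (R : quantaleType s d') (f : Q -> R) : Prop :=
  Algebra.nmod_morphism f /\
  (forall X : set Q, joinable s X -> f (qjoin X) = qjoin (f @` X)).

(* Multiplication is not required to be monotone in its right argument, except  *)
(* through [aq_iota_mul] below when the left factor lies in the image of iota. *)
HB.mixin Record isMulQuantale (s : setting) (d : Order.disp_t) A
    of Quantale s d A & monoid.Monoid A := {
  qmul_joinl : forall (X : set A) (b : A), joinable s X ->
    (qjoin X * b)%g = qjoin [set (a * b)%g | a in X];
  qmulDl : forall a b c : A, ((a + b)%R * c)%g = ((a * c)%g + (b * c)%g)%R;
  qmul0x : forall a : A, ((0%R : A) * a)%g = 0%R
}.

#[short(type="mulQuantaleType")]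
HB.structure Definition MulQuantale (s : setting) (d : Order.disp_t) :=
  {A of Quantale s d A & monoid.Monoid A & isMulQuantale s d A}.

(* The triple <A_d, A, iota>; it coerces to A. *)
Record additiveQuantale (s : setting) := AdditiveQuantale {
  aq_d : monoidType;
  aq_disp : Order.disp_t;
  aq_sort :> mulQuantaleType s aq_disp;
  aq_iota : aq_d -> aq_sort;
  aq_iota_morphism : monoid_morphism aq_iota;
  aq_iota_mul : forall u : aq_d,
    quantale_morphism (fun a : aq_sort => (aq_iota u * a)%g)
}.

HB.mixin Record isModule (s : setting) (A : additiveQuantale s)
    (d : Order.disp_t) Q of Quantale s d Q := {
  qact : A -> Q -> Q;
  qact_le : forall (a b : A) (x y : Q),
    a <= b -> x <= y -> qact a x <= qact b y;
  qactM : forall (a b : A) (x : Q), qact (a * b)%g x = qact a (qact b x);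
  qact1 : forall x : Q, qact 1%g x = x;
  qactDl : forall (a b : A) (x : Q),
    qact (a + b)%R x = (qact a x + qact b x)%R;
  qact0 : forall x : Q, qact 0%R x = 0%R;
  qact_joinl : forall (X : set A) (x : Q), joinable s X ->
    qact (qjoin X) x = qjoin [set qact a x | a in X];
  qact_iota : forall u : aq_d A,
    quantale_morphism (fun x : Q => qact (aq_iota u) x)
}.

#[short(type="moduleType")]
HB.structure Definition Module (s : setting) (A : additiveQuantale s)
    (d : Order.disp_t) := {Q of Quantale s d Q & isModule s A d Q}.

Section Notions.
Variables (s : setting) (A : additiveQuantale s).

Definition module_morphism (d d' : Order.disp_t)
    (Q : moduleType A d) (R : moduleType A d') (f : Q -> R) : Prop :=
  quantale_morphism f /\ (forall (a : A) (x : Q), f (qact a x) = qact a (f x)).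

Definition projective (d : Order.disp_t) (P : moduleType A d) : Prop :=
  forall (d1 d2 : Order.disp_t) (R : moduleType A d1) (S : moduleType A d2)
         (g : R -> S) (h : P -> S),
    module_morphism g -> (forall y : S, exists x : R, g x = y) ->
    module_morphism h ->
    exists h' : P -> R, module_morphism h' /\ g \o h' =1 h.

Record structuralNucleus (d : Order.disp_t) (Q : moduleType A d) :=
  StructuralNucleus {
    nuc_fun :> Q -> Q;
    nuc_le : forall x y : Q, x <= y -> nuc_fun x <= nuc_fun y;
    nuc_ge : forall x : Q, x <= nuc_fun x;
    nuc_idem : forall x : Q, nuc_fun (nuc_fun x) = nuc_fun x;
    nucD : forall x y : Q, (nuc_fun x + nuc_fun y)%R <= nuc_fun (x + y)%R;
    nuc_act : forall (a : A) (x : Q), qact a (nuc_fun x) <= nuc_fun (qact a x)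
  }.

(* The carrier gamma[Q] of Q_gamma, ordered as a subset of Q. *)
Definition nucImage (d : Order.disp_t) (Q : moduleType A d)
  (g : structuralNucleus Q) : Type := set_type (range g).

End Notions.

Section NucImage.
Variables (s : setting) (A : additiveQuantale s) (d : Order.disp_t).
Variables (Q : moduleType A d) (g : structuralNucleus Q).
Local Notation Qg := (nucImage g).

HB.instance Definition _ := SubChoice.on Qg.
HB.instance Definition _ := [SubChoice_isSubPOrder of Qg by <: with d].

Fact nuc_proj_subproof (x : Q) : g x \in range g.
Proof. by rewrite inE; exists x. Qed.

(* The corestriction of the nucleus to its image: Q -> Q_g *)
Definition nuc_proj (x : Q) : Qg := exist _ (g x) (nuc_proj_subproof x).

Definition nuc_join (X : set Qg) : Qg := nuc_proj (qjoin (val @` X)).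
Definition nuc_add (x y : Qg) : Qg := nuc_proj (val x + val y)%R.
Definition nuc_zero : Qg := nuc_proj 0%R.
Definition nuc_qact (a : A) (x : Qg) : Qg := nuc_proj (qact a (val x)).

HB.instance Definition _ := Algebra.hasAdd.Build Qg nuc_add.
HB.instance Definition _ := Algebra.hasZero.Build Qg nuc_zero.

Lemma nuc_projK (x : Qg) : g (val x) = val x.
Proof.
by case: x => /= x; rewrite inE => -[y _ <-]; exact: nuc_idem.
Qed.

Lemma nuc_val_proj (x : Q) : val (nuc_proj x) = g x. Proof. by []. Qed.

Lemma nuc_proj_val (x : Qg) : nuc_proj (val x) = x.
Proof. by apply: val_inj; rewrite nuc_val_proj nuc_projK. Qed.

Lemma nuc_leE (x y : Qg) : (x <= y) = (val x <= val y).
Proof. by []. Qed.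

Lemma nuc_proj_surj (y : Qg) : exists x : Q, nuc_proj x = y.
Proof. by exists (val y); exact: nuc_proj_val. Qed.

Lemma joinable_image (T U : Type) (f : T -> U) (X : set T) :
  joinable s X -> joinable s (f @` X).
Proof. by case: (s) => //= -[x Xx]; exists (f x); exists x. Qed.

Lemma nuc_absorb (x y : Q) : x <= y -> y <= g x -> nuc_proj x = nuc_proj y.
Proof.
move=> xy ygx; apply: val_inj; apply/le_anti; rewrite !nuc_val_proj nuc_le //=.
by rewrite -[leRHS]nuc_idem nuc_le.
Qed.

Lemma nuc_projD (x y : Q) :
  nuc_proj (x + y)%R = nuc_add (nuc_proj x) (nuc_proj y).
Proof. by apply: nuc_absorb; [apply: qadd_le; exact: nuc_ge|exact: nucD]. Qed.

Lemma nuc_proj_act (a : A) (x : Q) :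
  nuc_proj (qact a x) = nuc_qact a (nuc_proj x).
Proof.
by apply: nuc_absorb; [apply: qact_le => //; exact: nuc_ge|exact: nuc_act].
Qed.

Lemma nuc_proj_join (X : set Q) :
  joinable s X -> nuc_proj (qjoin X) = nuc_join (nuc_proj @` X).
Proof.
move=> jX; have [ub lb] := qjoinP _ jX.
have jX' : joinable s (val @` (nuc_proj @` X)) by do 2!apply: joinable_image.
have [ub' lb'] := qjoinP _ jX'.
apply: nuc_absorb.
  apply: lb => x Xx; apply: (le_trans (nuc_ge g x)); apply: ub'.
  by exists (nuc_proj x) => //; exists x.
by apply: lb' => _ [_ [x Xx <-] <-]; apply/nuc_le/ub.
Qed.

Fact nuc_joinP (X : set Qg) : joinable s X -> supremums X (nuc_join X).
Proof.
move=> jX; have [ub lb] := qjoinP _ (joinable_image val jX); split.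
  move=> x Xx; rewrite nuc_leE; apply: le_trans (nuc_ge g _).
  by apply: ub; exists x.
move=> y uby; rewrite nuc_leE -[val y]nuc_projK; apply/nuc_le/lb.
by move=> _ [x Xx <-]; rewrite -nuc_leE; exact: uby.
Qed.

Fact nuc_addA : associative nuc_add.
Proof.
move=> x y z; rewrite -(nuc_proj_val x) -(nuc_proj_val y) -(nuc_proj_val z).
by rewrite -!nuc_projD qaddA.
Qed.

Fact nuc_add0x : left_id nuc_zero nuc_add.
Proof. by move=> x; rewrite -(nuc_proj_val x) -nuc_projD qadd0x. Qed.

Fact nuc_addx0 : right_id nuc_zero nuc_add.
Proof. by move=> x; rewrite -(nuc_proj_val x) -nuc_projD qaddx0. Qed.

Fact nuc_add_le (x x' y y' : Qg) :
  x <= x' -> y <= y' -> nuc_add x y <= nuc_add x' y'.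
Proof. by rewrite !nuc_leE => xx' yy'; apply/nuc_le/qadd_le. Qed.

Fact nuc_add_joinl (X : set Qg) (y : Qg) : joinable s X ->
  nuc_add (nuc_join X) y = nuc_join [set nuc_add x y | x in X].
Proof.
move=> jX; have jvX := joinable_image val jX.
rewrite -[y in LHS]nuc_proj_val -nuc_projD qadd_joinl //.
rewrite nuc_proj_join; last exact: joinable_image.
by rewrite !image_comp.
Qed.

Fact nuc_add_joinr (y : Qg) (X : set Qg) : joinable s X ->
  nuc_add y (nuc_join X) = nuc_join [set nuc_add y x | x in X].
Proof.
move=> jX; have jvX := joinable_image val jX.
rewrite -[y in LHS]nuc_proj_val -nuc_projD qadd_joinr //.
rewrite nuc_proj_join; last exact: joinable_image.
by rewrite !image_comp.
Qed.

HB.instance Definition _ := isQuantale.Build s d Qg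
  nuc_joinP nuc_addA nuc_add0x nuc_addx0 nuc_add_le nuc_add_joinl nuc_add_joinr.

Fact nuc_qact_le (a b : A) (x y : Qg) :
  a <= b -> x <= y -> nuc_qact a x <= nuc_qact b y.
Proof. by rewrite !nuc_leE => ab xy; apply/nuc_le/qact_le. Qed.

Fact nuc_qactM (a b : A) (x : Qg) :
  nuc_qact (a * b)%g x = nuc_qact a (nuc_qact b x).
Proof. by rewrite -(nuc_proj_val x) -!nuc_proj_act qactM. Qed.

Fact nuc_qact1 (x : Qg) : nuc_qact 1%g x = x.
Proof. by rewrite -(nuc_proj_val x) -nuc_proj_act qact1. Qed.

Fact nuc_qactDl (a b : A) (x : Qg) :
  nuc_qact (a + b)%R x = nuc_add (nuc_qact a x) (nuc_qact b x).
Proof. by rewrite -(nuc_proj_val x) -!nuc_proj_act -nuc_projD qactDl. Qed.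

Fact nuc_qact0 (x : Qg) : nuc_qact 0%R x = nuc_zero.
Proof. by rewrite -(nuc_proj_val x) -nuc_proj_act qact0. Qed.

Fact nuc_qact_joinl (X : set A) (x : Qg) : joinable s X ->
  nuc_qact (qjoin X) x = qjoin [set nuc_qact a x | a in X].
Proof.
move=> jX; rewrite -[x in LHS]nuc_proj_val -nuc_proj_act qact_joinl //.
by rewrite nuc_proj_join; [rewrite image_comp|exact: joinable_image].
Qed.

Fact nuc_qact_iota (u : aq_d A) :
  quantale_morphism (fun x : Qg => nuc_qact (aq_iota u) x).
Proof.
have [[u0 uD] uJ] := @qact_iota _ A d Q u.
split; first split.
- by rewrite -nuc_proj_act u0.
- move=> x y; rewrite -[in LHS](nuc_proj_val x) -[in LHS](nuc_proj_val y).
  rewrite -[(_ + _)%R in LHS]/(nuc_add _ _) -nuc_projD -nuc_proj_act uD.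
  exact: nuc_projD.
- move=> X jX; have jvX := joinable_image val jX.
  rewrite -nuc_proj_act uJ // nuc_proj_join; last exact: joinable_image.
  by rewrite !image_comp.
Qed.

HB.instance Definition _ := isModule.Build s A d Qg
  nuc_qact_le nuc_qactM nuc_qact1 nuc_qactDl nuc_qact0 nuc_qact_joinl
  nuc_qact_iota.

Lemma nuc_proj_morphism : module_morphism nuc_proj.
Proof.
split; last exact: nuc_proj_act.
by split; [split; [|exact: nuc_projD]|exact: nuc_proj_join].
Qed.

End NucImage.

(* Main.v *)
Require Import Defs.
From mathcomp Require Import all_boot all_order.
From mathcomp Require Import boolp classical_sets.

Set Implicit Arguments.
Unset Strict Implicit.
Unset Printing Implicit Defensive.

Import Order.POrderTheory.
Local Open Scope classical_set_scope.
Local Open Scope order_scope.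

(** Every module homomorphism [h] out of [Q] induces a structural nucleus on
    [Q], sending [x] to the largest [y] with [h y <= h x], and [h] factors
    through it as an embedding of the image. If the lifting property for
    embeddings holds and [g : R -> S] is surjective, the nucleus of [g] presents
    [S] as an image of [R], so any [h : P -> S] becomes an embedding of the
    image of its own nucleus, and the [tau] lifting it is a lift of [h] along [g].
    Conversely, projectivity lifts [f \o gamma] along the surjection [delta]. *)

Section Morphisms.
Variables (s : setting) (A : additiveQuantale s).

Lemma mem_joinable (T : Type) (X : set T) (x : T) : X x -> joinable s X.
Proof. by case: s => //= Xx; exists x. Qed.

Lemma le_qjoin (d : Order.disp_t) (Q : quantaleType s d) (X : set Q) (x : Q) :
  X x -> x <= qjoin X.
Proof.
by move=> Xx; have [ub _] := qjoinP _ (mem_joinable Xx); exact: ub.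
Qed.

(** The order is recovered from joins: [x <= y] makes [y] the join of the pair [x], [y], which is
    nonempty and hence joinable in both settings. *)
Lemma quantale_morphism_le (d d' : Order.disp_t) (Q : quantaleType s d)
    (R : quantaleType s d') (f : Q -> R) :
  quantale_morphism f -> {homo f : x y / x <= y}.
Proof.
move=> [_ fJ] x y xy.
have jX : joinable s [set x; y] by apply: (@mem_joinable _ _ x); left.
have -> : y = qjoin [set x; y].
  apply/le_anti; rewrite le_qjoin /=; last by right.
  by have [_ lb] := qjoinP _ jX; apply: lb => _ [->|->].
by rewrite fJ //; apply: le_qjoin; exists x => //; left.
Qed.

Lemma module_morphism_comp (d1 d2 d3 : Order.disp_t) (P : moduleType A d1)
    (Q : moduleType A d2) (R : moduleType A d3) (f : Q -> R) (g : P -> Q) :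
  module_morphism f -> module_morphism g -> module_morphism (f \o g).
Proof.
move=> [[[f0 fD] fJ] fA] [[[g0 gD] gJ] gA]; split; last first.
  by move=> a x /=; rewrite gA fA.
split; first by split=> [|x y] /=; rewrite (g0, gD) (f0, fD).
move=> X jX /=; rewrite gJ // fJ ?image_comp //.
exact: joinable_image.
Qed.

Lemma module_morphism_cancel (d1 d2 d3 : Order.disp_t) (P : moduleType A d1)
    (Q : moduleType A d2) (R : moduleType A d3) (f : Q -> R) (g : P -> Q) :
  module_morphism f -> injective f -> module_morphism (f \o g) ->
  module_morphism g.
Proof.
move=> [[[f0 fD] fJ] fA] finj [[[h0 hD] hJ] hA]; split; last first.
  by move=> a x; apply: finj; rewrite fA; exact: hA.
split; first split.
- by apply: finj; rewrite f0; exact: h0.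
- by move=> x y; apply: finj; rewrite fD; exact: hD.
- move=> X jX; apply: finj; rewrite fJ ?image_comp; first exact: hJ.
  exact: joinable_image.
Qed.

End Morphisms.

Section KernelNucleus.
Variables (s : setting) (A : additiveQuantale s) (d d' : Order.disp_t).
Variables (Q : moduleType A d) (S : moduleType A d') (h : Q -> S).
Hypothesis hmor : module_morphism h.

(** The set joined here contains [x], so its join exists in the generalized setting too. *)
Definition kernel_fun (x : Q) : Q := qjoin [set y | h y <= h x].

Let h_le : {homo h : x y / x <= y} := quantale_morphism_le hmor.1.

(** As [h] preserves the defining join, the left side is a join of elements below [h x], one of them
    [h x] itself. *)
Lemma kernel_funK (x : Q) : h (kernel_fun x) = h x.
Proof.
have jX : joinable s [set y | h y <= h x].
  by apply: (@mem_joinable _ _ _ x) => /=.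
apply/le_anti/andP; split; last exact/h_le/le_qjoin/lexx.
rewrite hmor.1.2 //; have [_ lb] := qjoinP _ (joinable_image h jX).
by apply: lb => _ [y yx <-].
Qed.

(** An adjunction-like rule: it moves the inequalities among the nucleus axioms into [S], where
    [kernel_funK] erases [kernel_fun]. *)
Lemma le_kernel_fun (x y : Q) : (x <= kernel_fun y) = (h x <= h y).
Proof.
apply/idP/idP => [/h_le|xy]; first by rewrite kernel_funK.
exact: le_qjoin.
Qed.

Lemma kernel_fun_le (x y : Q) : x <= y -> kernel_fun x <= kernel_fun y.
Proof. by move=> xy; rewrite le_kernel_fun kernel_funK h_le. Qed.

Lemma kernel_fun_ge (x : Q) : x <= kernel_fun x.
Proof. by rewrite le_kernel_fun. Qed.

Lemma kernel_fun_idem (x : Q) : kernel_fun (kernel_fun x) = kernel_fun x.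
Proof. by rewrite {1}/kernel_fun kernel_funK. Qed.

Lemma kernel_funD (x y : Q) :
  (kernel_fun x + kernel_fun y)%R <= kernel_fun (x + y)%R.
Proof.
by have [[[_ hD] _] _] := hmor; rewrite le_kernel_fun !hD !kernel_funK.
Qed.

Lemma kernel_fun_act (a : A) (x : Q) :
  qact a (kernel_fun x) <= kernel_fun (qact a x).
Proof. by have [_ hA] := hmor; rewrite le_kernel_fun !hA kernel_funK. Qed.

Definition kernel_nucleus : structuralNucleus Q :=
  StructuralNucleus kernel_fun_le kernel_fun_ge kernel_fun_idem
    kernel_funD kernel_fun_act.

Definition kernel_embed (x : nucImage kernel_nucleus) : S := h (val x).

Lemma kernel_embed_proj (x : Q) :
  kernel_embed (nuc_proj kernel_nucleus x) = h x.
Proof. exact: kernel_funK. Qed.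

Lemma kernel_embed_inj : injective kernel_embed.
Proof.
(* Points of the image are fixed by [kernel_fun], whose value depends on its argument only through
   [h]. *)
move=> x y hxy; apply: val_inj; rewrite -(nuc_projK x) -(nuc_projK y) /=.
by rewrite /kernel_fun -[h (val x)]/(kernel_embed x) hxy.
Qed.

Lemma kernel_embed_morphism : module_morphism kernel_embed.
Proof.
have [[[h0 hD] hJ] hA] := hmor; split; last first.
  by move=> a x; rewrite kernel_embed_proj hA.
split; first split.
- by rewrite kernel_embed_proj.
- by move=> x y; rewrite kernel_embed_proj hD.
- move=> X jX; rewrite kernel_embed_proj hJ ?image_comp //.
  exact: joinable_image.
Qed.

End KernelNucleus.

Theorem theorem7p1 (s : setting) (A : additiveQuantale s) (d : Order.disp_t)
    (P : moduleType A d) :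
  projective P <->
  (forall (d' : Order.disp_t) (Q : moduleType A d')
      (gamma : structuralNucleus P) (delta : structuralNucleus Q)
      (f : nucImage gamma -> nucImage delta),
    module_morphism f -> injective f ->
    exists tau : P -> Q,
      module_morphism tau /\ f \o nuc_proj gamma =1 nuc_proj delta \o tau).
Proof.
split=> [projP d' Q gamma delta f fmor _|lift d1 d2 R S g h gmor gsurj hmor].
  have [tau [taumor tauE]] := projP _ _ _ _ _ _ (nuc_proj_morphism delta)
    (@nuc_proj_surj _ _ _ _ delta)
    (module_morphism_comp fmor (nuc_proj_morphism gamma)).
  by exists tau; split=> // x; rewrite tauE.
(* Since [g] is surjective, its embedding is a bijection onto [S]; [r] is the embedding for [h]
   followed by the inverse of that bijection. *)
have /choice[r rE] (x : nucImage (kernel_nucleus hmor)) :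
    exists y, kernel_embed (hmor := gmor) y = kernel_embed x.
  have [y yE] := gsurj (kernel_embed x).
  by exists (nuc_proj _ y); rewrite kernel_embed_proj.
(* Although [r] is chosen pointwise, composing it with the injective embedding for [g] gives a
   morphism, so [r] is one. *)
have rmor : module_morphism r.
  apply: (module_morphism_cancel (kernel_embed_morphism gmor)).
    exact: kernel_embed_inj.
  have -> : kernel_embed (hmor := gmor) \o r = kernel_embed (hmor := hmor).
    exact/funext.
  exact: kernel_embed_morphism.
have rinj : injective r.
  by move=> x y rxy; apply: kernel_embed_inj; rewrite -!rE rxy.
have [tau [taumor tauE]] := lift _ _ _ _ _ rmor rinj.
exists tau; split=> // x /=.
have /= := tauE x => tauxE.
(* Pass from [g (tau x)] to the image of the nucleus of [g], replace the class of [tau x] by [r] of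
   the class of [x], and return to [h x]. *)
by rewrite -(kernel_embed_proj gmor) -tauxE rE kernel_embed_proj.
Qed.
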